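(* Let $n\ge 0$, let $\mathcal K_i$ denote throughout one of $\mathcal P_i$, $\mathcal B_i$, $\mathcal{PB}_i$ (the same choice for all $i$), and let $0\le r\le n$. Then $$e(D_r(\mathcal K_n))=\sum_{\mu\vdash n}e_\mu(D_r(\mathcal K_n)).$$ If $\mu=(m_1,\dots,m_k)\vdash n$ is an integer partition having exactly $\mu_i$ parts equal to $i$ for each $i$, then $$e_\mu(D_r(\mathcal K_n))=\frac{n!}{\prod_{i=1}^n\mu_i!\,(i!)^{\mu_i}}\ \sum_{\substack{A\subseteq\{1,\dots,k\}\\ |A|=r}}\Bigg(\prod_{i\in A}c_1(\mathcal K_{m_i})\cdot\prod_{j\in\{1,\dots,k\}\setminus A}c_0(\mathcal K_{m_j})\Bigg).$$
   Context: Write $\mathbf n=\{1,\dots,n\}$ and let $\mathbf n'$ be a disjoint copy. $\mathcal P_n$ is the monoid of all set partitions $\alpha$ (into non-empty blocks) of $\mathbf n\cup\mathbf n'$. Product: for $\alpha,\beta\in\mathcal P_n$ take a third copy $\mathbf n''$; relabel each lower vertex $x'$ of $\alpha$ as $x''$ and each upper vertex $x$ of $\beta$ as $x''$, and take the union graph $\Gamma(\alpha,\beta)$ on $\mathbf n\cup\mathbf n'\cup\mathbf n''$ (a partition being represented by a graph whose connected components are its blocks); $x,y\in\mathbf n\cup\mathbf n'$ are in the same block of $\alpha\beta$ iff they are joined by a path in $\Gamma(\alpha,\beta)$. $\mathcal{PB}_n$ is the submonoid of partitions all of whose blocks have size at most $2$, and $\mathcal B_n$ the submonoid of partitions all of whose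 blocks have size exactly $2$. $\mathcal P_0=\mathcal B_0=\mathcal{PB}_0=\{\emptyset\}$. The rank of $\alpha$ is the number of blocks meeting both $\mathbf n$ and $\mathbf n'$. $D_r(\mathcal K_n)=\{\alpha\in\mathcal K_n:\operatorname{rank}(\alpha)=r\}$. For $\alpha\in\mathcal P_n$, $\ker^\wedge(\alpha)$ (resp. $\ker_\vee(\alpha)$) is the equivalence on $\mathbf n$ relating $x,y$ iff $x,y$ (resp. $x',y'$) are in the same block of $\alpha$; $\ker(\alpha)=\ker^\wedge(\alpha)\vee\ker_\vee(\alpha)$ is the smallest equivalence containing both; its classes are the kernel-classes of $\alpha$. $\alpha$ is irreducible if $\ker(\alpha)=\mathbf n\times\mathbf n$. $\mu(\alpha)$ is the integer partition of $n$ whose parts are the sizes of the kernel-classes of $\alpha$. For $\Sigma\subseteq\mathcal P_n$: $e(\Sigma)$ is the number of $\alpha\in\Sigma$ with $\alpha^2=\alpha$; for $\mu\vdash n$, $e_\mu(\Sigma)$ is the number of $\alpha\in\Sigma$ with $\alpha^2=\alpha$ and $\mu(\alpha)=\mu$; for $r\in\{0,1\}$, $c_r(\Sigma)$ is the number of irreducible $\alpha\in\Sigma$ with $\alpha^2=\alpha$ and $\operatorname{rank}(\alpha)=r$. *)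

(* Defs.v *)
From HB Require Import structures.
From mathcomp Require Import all_boot all_order all_algebra.

Set Implicit Arguments.
Unset Strict Implicit.
Unset Printing Implicit Defensive.

(* inl x is the upper vertex x, inr x is the lower vertex x'. *)
Definition vertex (n : nat) : finType := ('I_n + 'I_n)%type.

(* P_n; [partition] includes that blocks are non-empty. *)
Definition diagram (n : nat) : finType :=
  {P : {set {set vertex n}} | partition P [set: vertex n]}.

Definition blocks n (a : diagram n) : {set {set vertex n}} := val a.

Definition same_block n (a : diagram n) : rel (vertex n) :=
  [rel x y | [exists B in blocks a, (x \in B) && (y \in B)]].

Lemma same_block_equiv n (a : diagram n) :
  {in [set: vertex n] & &, equivalence_rel (same_block a)}.
Proof.
have [/eqP covP tiP _] := and3P (valP a).
have sbE x y : same_block a x y = (y \in pblock (blocks a) x).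
  apply/existsP/idP => [[B /and3P[aB Bx By]]|yx].
    by rewrite (def_pblock tiP aB Bx).
  exists (pblock (blocks a) x).
  by rewrite yx mem_pblock pblock_mem covP ?inE.
move=> x y z _ _ _; split; first by rewrite sbE mem_pblock covP inE.
by rewrite !sbE => yx; rewrite (same_pblock tiP yx).
Qed.

(* In the graph Gamma(a, b), inl v is the outer vertex v (upper or lower) and
   inr x is the middle vertex x''. *)
Definition in_upper n (v : vertex n) : vertex n + 'I_n :=
  match v with inl x => inl (inl x) | inr x => inr x end.
Definition in_lower n (v : vertex n) : vertex n + 'I_n :=
  match v with inl x => inr x | inr x => inl (inr x) end.

(* Each partition is represented by the graph in which any two vertices of a
   common block are adjacent. *)
Definition Gamma n (a b : diagram n) : rel (vertex n + 'I_n) :=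
  [rel p q |
     [exists u, exists v, [&& same_block a u v, p == in_upper u & q == in_upper v]]
  || [exists u, exists v, [&& same_block b u v, p == in_lower u & q == in_lower v]]].

Definition joined n (a b : diagram n) : rel (vertex n) :=
  [rel x y | connect (Gamma a b) (inl x) (inl y)].

Lemma same_block_sym n (a : diagram n) : symmetric (same_block a).
Proof. by move=> x y; apply: eq_existsb => B; rewrite [(x \in B) && _]andbC. Qed.

Lemma Gamma_sym n (a b : diagram n) : symmetric (Gamma a b).
Proof.
suff sub p q : Gamma a b p q -> Gamma a b q p by move=> p q; apply/idP/idP; apply: sub.
case/orP=> /existsP[u /existsP[v /and3P[uv pu qv]]]; apply/orP; [left|right];
  by apply/existsP; exists v; apply/existsP; exists u; rewrite same_block_sym uv pu qv.
Qed.

Lemma joined_equiv n (a b : diagram n) :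
  {in [set: vertex n] & &, equivalence_rel (joined a b)}.
Proof.
move=> x y z _ _ _; split=> [|xy]; first exact: connect0.
exact: (same_connect (sym_connect_sym (@Gamma_sym n a b)) xy).
Qed.

Definition diagram_mul n (a b : diagram n) : diagram n :=
  exist _ (equivalence_partition (joined a b) [set: vertex n])
          (equivalence_partitionP (@joined_equiv n a b)).

Definition idempotent n (a : diagram n) : bool := diagram_mul a a == a.

Definition rank n (a : diagram n) : nat :=
  #|[set B in blocks a | [exists x, inl x \in B] && [exists x, inr x \in B]]|.

Inductive diagram_family := PartitionMonoid | BrauerMonoid | PartialBrauerMonoid.

Definition diagram_monoid (K : diagram_family) (n : nat) : {set diagram n} :=
  match K with
  | PartitionMonoid => [set: diagram n]
  | BrauerMonoid => [set a | [forall B in blocks a, #|B| == 2]]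
  | PartialBrauerMonoid => [set a | [forall B in blocks a, #|B| <= 2]]
  end.

Definition D (r : nat) (K : diagram_family) (n : nat) : {set diagram n} :=
  [set a in diagram_monoid K n | rank a == r].

Definition ker_upper n (a : diagram n) : rel 'I_n :=
  [rel x y | same_block a (inl x) (inl y)].
Definition ker_lower n (a : diagram n) : rel 'I_n :=
  [rel x y | same_block a (inr x) (inr y)].

(* The join of two equivalences is the transitive closure of their union;
   ker_equiv, ker_upper_sub, ker_lower_sub and ker_min below show that this is
   the smallest equivalence containing both. *)
Definition ker n (a : diagram n) : rel 'I_n :=
  connect (relU (ker_upper a) (ker_lower a)).

Lemma ker_equiv n (a : diagram n) : equivalence_rel (ker a).
Proof.
move=> x y z; split=> [|xy]; first exact: connect0.
apply: (same_connect _ xy); apply: sym_connect_sym => u v.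
congr (_ || _); exact: same_block_sym.
Qed.

Lemma ker_upper_sub n (a : diagram n) : subrel (ker_upper a) (ker a).
Proof. by move=> x y xy; apply: connect1; apply/orP; left. Qed.

Lemma ker_lower_sub n (a : diagram n) : subrel (ker_lower a) (ker a).
Proof. by move=> x y xy; apply: connect1; apply/orP; right. Qed.

Lemma ker_min n (a : diagram n) (e : rel 'I_n) : equivalence_rel e ->
  subrel (ker_upper a) e -> subrel (ker_lower a) e -> subrel (ker a) e.
Proof.
move=> eqe sub_u sub_l x y /connectP[p].
elim: p x => [|z p IHp] x /=; first by move=> _ ->; have [] := eqe x x x.
case/andP=> xz zp def_y; have [_ ->] := eqe x z y; first exact: IHp.
by case/orP: xz => [/sub_u | /sub_l].
Qed.

Definition kernel_classes n (a : diagram n) : {set {set 'I_n}} :=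
  equivalence_partition (ker a) [set: 'I_n].

Definition irreducible n (a : diagram n) : bool := [forall x, forall y, ker a x y].

(* Integer partitions of n, listed as weakly decreasing sequences of positive
   parts. *)
Definition is_intpart (n : nat) (s : seq nat) : bool :=
  [&& sorted geq s, all (fun m => 0 < m) s & sumn s == n].

Record intpart (n : nat) := IntPart {
  parts :> seq nat;
  _ : is_intpart n parts }.

HB.instance Definition _ n := [isSub for @parts n].
HB.instance Definition _ n := [Countable of intpart n by <:].

Definition intpart_to_bseq n (mu : intpart n) : n.-bseq 'I_n.+1 :=
  insub_bseq n [seq inord m | m <- parts mu].
Definition intpart_of_bseq n (s : n.-bseq 'I_n.+1) : option (intpart n) :=
  insub [seq val m | m <- s].

Lemma intpart_bseqK n : pcancel (@intpart_to_bseq n) (@intpart_of_bseq n).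
Proof.
case=> s s_n; have /and3P[_ s_gt0 /eqP sum_s] := s_n.
have size_s : size s <= n.
  rewrite -sum_s; elim: s s_gt0 {s_n sum_s} => //= m s IHs /andP[m0 /IHs].
  by rewrite -add1n; apply: leq_add.
have le_n m : m \in s -> m < n.+1.
  rewrite ltnS -sum_s; elim: s {s_n s_gt0 sum_s size_s} => //= k s IHs.
  rewrite inE => /predU1P[-> | /IHs le_m]; first exact: leq_addr.
  exact: leq_trans le_m (leq_addl _ _).
rewrite /intpart_of_bseq /intpart_to_bseq val_insubd /= size_map size_s -map_comp.
have -> : [seq (val \o (@inord n)) m | m <- s] = s.
  by rewrite -[RHS]map_id; apply/eq_in_map => m /le_n m_n /=; rewrite inordK.
by rewrite (insubT (is_intpart n) s_n) /=; congr Some; apply: val_inj.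
Qed.

HB.instance Definition _ n : isFinite (intpart n) := PCanIsFinite (@intpart_bseqK n).

Definition kernel_sizes n (a : diagram n) : seq nat :=
  sort geq [seq #|B| | B : {set 'I_n} in kernel_classes a].

Lemma kernel_sizesP n (a : diagram n) : is_intpart n (kernel_sizes a).
Proof.
have ker_part : partition (kernel_classes a) [set: 'I_n].
  by apply: equivalence_partitionP => x y z _ _ _; apply: ker_equiv.
apply/and3P; split.
- by apply: sort_sorted => x y; apply: leq_total.
- rewrite all_sort; apply/allP => _ /imageP[B aB ->].
  have [_ _ not0] := and3P ker_part.
  by rewrite card_gt0; apply: contraNneq not0 => <-.
- rewrite (perm_sumn (permEl (perm_sort _ _))) sumnE big_map big_enum /=.
  by rewrite -(card_partition ker_part) cardsT card_ord.
Qed.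

Definition mu_of n (a : diagram n) : intpart n := IntPart (kernel_sizesP a).

Definition e n (S : {set diagram n}) : nat := #|[set a in S | idempotent a]|.

Definition e_mu n (mu : intpart n) (S : {set diagram n}) : nat :=
  #|[set a in S | idempotent a && (mu_of a == mu)]|.

(* Only used for r = 0 and r = 1. *)
Definition c (r : nat) n (S : {set diagram n}) : nat :=
  #|[set a in S | [&& irreducible a, idempotent a & rank a == r]]|.

(* Main.v *)
Require Import Defs.
From mathcomp Require Import all_boot all_order all_algebra.

(** Write [u ~ v] for two vertices in a common block of [a].  The proof rests on
    a local description of idempotency ([idempotentP]): [a] is idempotent iff
    every transversal block lies over a single kernel-class (if [x ~ y'] then
    [ker a x y]) and each kernel-class supports at most one transversal block.
    The reason is that two middle vertices of [Gamma a a] are connected exactly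
    when they are related by [ker a]: the lower blocks of the first factor and
    the upper blocks of the second one together generate the join of the two
    kernels.  Hence an idempotent is the disjoint union of its restrictions to
    its kernel-classes, these restrictions are irreducible idempotents, and an
    irreducible idempotent has rank 0 or 1; conversely any choice of an
    irreducible idempotent on each class glues to an idempotent.  Ranks add up
    and block sizes are preserved, so for a fixed set partition into classes of
    sizes m_1, ..., m_k the idempotents of rank [r] are counted by choosing the
    set [A] of the classes that carry a transversal block
    ([card_summand_families], [card_adapted]).

    It remains to count set partitions of type [mu].  Standard identifications
    of each class with an initial interval are avoided by counting pairs
    [(a, g)], where [g] is a bijection from the cells
    [{i : 'I_k & 'I_(m i)}] onto ['I_n] that carries the fibres of [tag] to the
    kernel-classes of [a].  For a fixed [g] the idempotents [a] are the families
    of irreducible idempotents of degrees [m i], whatever [g] is, and there are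
    [n`!] bijections [g].  For a fixed [a] with [mu_of a = mu], the number of
    [g] is the product of the [mu_i`! * i`! ^ mu_i]: first label the classes by
    indices of parts of the same size, then number the elements of each class.
    Both of these choices are injections over a base set, counted by
    [card_injections_over].  Comparing the two counts ([e_mu_symmetries]) gives
    the formula. *)

Set Implicit Arguments.
Unset Strict Implicit.
Unset Printing Implicit Defensive.

(** * Diagrams as equivalence relations *)

Lemma connect_ind (T : finType) (e : rel T) (P : T -> Prop) x :
  (forall y z, P y -> e y z -> P z) -> P x -> forall y, connect e x y -> P y.
Proof.
move=> Pe Px y /connectP[p]; elim: p x Px => [x Px _ -> //|z p IHp x Px] /=.
by case/andP=> xz; apply: IHp; apply: Pe xz.
Qed.

Section SameBlock.
Variables (n : nat) (a : diagram n).

Lemma same_block_refl u : same_block a u u.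
Proof. by have [] := same_block_equiv a (in_setT u) (in_setT u) (in_setT u). Qed.

Lemma same_block_trans v u w :
  same_block a u v -> same_block a v w -> same_block a u w.
Proof.
have [_ uvE] := same_block_equiv a (in_setT u) (in_setT v) (in_setT w).
by move=> /uvE ->.
Qed.

(** Blocks are the classes of [same_block a], so every statement about a diagram
    can be reduced to one about this relation. *)
Lemma mem_blocksP B :
  reflect (exists u, B = [set v | same_block a u v]) (B \in blocks a).
Proof.
have /and3P[/eqP cov tiB B0] := valP a.
have blockE C u : C \in blocks a -> u \in C -> C = [set v | same_block a u v].
  move=> aC Cu; apply/setP=> v; rewrite inE; apply/idP/existsP => [Cv|].
    by exists C; rewrite aC Cu.
  case=> C' /and3P[aC' C'u C'v].
  by rewrite -(def_pblock tiB aC Cu) (def_pblock tiB aC' C'u).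
apply: (iffP idP) => [aB | [u ->]].
  have /set0Pn[u Bu]: B != set0 by apply: contraNneq B0 => <-.
  by exists u; apply: blockE.
have /existsP[C /and3P[aC Cu _]] := same_block_refl u.
by rewrite -(blockE C u).
Qed.

End SameBlock.

Lemma eq_diagram n (a b : diagram n) : same_block a =2 same_block b -> a = b.
Proof.
move=> eq_ab; apply: val_inj; apply/setP=> B.
by apply/mem_blocksP/mem_blocksP=> -[u ->]; exists u; apply/setP=> v;
  rewrite !inE eq_ab.
Qed.

Definition diagram_of_rel n (R : rel (vertex n))
    (eqR : {in [set: vertex n] & &, equivalence_rel R}) : diagram n :=
  exist _ (equivalence_partition R [set: vertex n]) (equivalence_partitionP eqR).

Lemma same_block_of_rel n (R : rel (vertex n)) eqR u v :
  same_block (@diagram_of_rel n R eqR) u v = R u v.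
Proof.
set a := diagram_of_rel eqR.
have /and3P[/eqP cov tiB _] := valP a.
rewrite -(pblock_equivalence_partition eqR (in_setT u) (in_setT v)).
have aP: pblock (blocks a) u \in blocks a by rewrite pblock_mem // cov inE.
apply/existsP/idP => [[B /and3P[aB Bu Bv]] | uv].
  by rewrite -[equivalence_partition _ _]/(blocks a) (def_pblock tiB aB Bu).
exists (pblock (blocks a) u).
by rewrite aP mem_pblock cov inE /=.
Qed.

(** * Idempotency and kernel-classes *)

Section Idempotent.
Variables (n : nat) (a : diagram n).

Lemma ker_refl x : ker a x x.
Proof. exact: connect0. Qed.

Lemma ker_sym x y : ker a x y = ker a y x.
Proof.
by apply: sym_connect_sym => u v; congr (_ || _); apply: same_block_sym.
Qed.

Lemma ker_trans y x z : ker a x y -> ker a y z -> ker a x z.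
Proof. exact: connect_trans. Qed.

(** The edges of [Gamma a a] come from the two copies of [a], so an invariant of
    connected components only has to be checked on each copy. *)
Lemma Gamma_ind (P : vertex n + 'I_n -> Prop) p :
    (forall u v, same_block a u v -> P (in_upper u) -> P (in_upper v)) ->
    (forall u v, same_block a u v -> P (in_lower u) -> P (in_lower v)) ->
  P p -> forall q, connect (Gamma a a) p q -> P q.
Proof.
move=> Pu Pl; apply: connect_ind => y z Py.
by case/orP=> /existsP[u /existsP[v /and3P[uv /eqP def_y /eqP def_z]]];
  move: Py; rewrite def_y def_z; [apply: Pu | apply: Pl].
Qed.

Lemma upper_edge u v :
  same_block a u v -> connect (Gamma a a) (in_upper u) (in_upper v).
Proof.
move=> uv; apply: connect1; apply/orP; left.
by apply/existsP; exists u; apply/existsP; exists v; rewrite uv !eqxx.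
Qed.

Lemma lower_edge u v :
  same_block a u v -> connect (Gamma a a) (in_lower u) (in_lower v).
Proof.
move=> uv; apply: connect1; apply/orP; right.
by apply/existsP; exists u; apply/existsP; exists v; rewrite uv !eqxx.
Qed.

(** Seen from the middle row, the upper copy contributes [ker_lower a] and the
    lower copy [ker_upper a]; a path that leaves the middle row stays in one
    block until it comes back, so it gives nothing new. *)
Lemma connect_middle x y : connect (Gamma a a) (inr x) (inr y) = ker a x y.
Proof.
apply/idP/idP=> [| xy].
  (* Outer vertices are tracked through the middle vertices of their block. *)
  pose P p := match p with
    | inr q => ker a x q
    | inl (inl v) => exists2 z, same_block a (inl v) (inr z) & ker a x z
    | inl (inr v) => exists2 z, same_block a (inl z) (inr v) & ker a x z
    end.
  move=> xy; suff: P (inr y) by [].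
  apply: Gamma_ind xy => [u v uv|u v uv|]; last exact: ker_refl.
  - case: u v uv => u [] v uv /=.
    + by case=> z uz; exists z => //; apply: same_block_trans uz; rewrite same_block_sym.
    + case=> z uz xz; apply: ker_trans xz (ker_lower_sub _) => /=.
      by apply: same_block_trans uv; rewrite same_block_sym.
    + by move=> xu; exists u => //; rewrite same_block_sym.
    + by move=> xu; apply: ker_trans xu (ker_lower_sub _).
  - case: u v uv => u [] v uv /=.
    + by move=> xu; apply: ker_trans xu (ker_upper_sub _).
    + by move=> xu; exists u.
    + case=> z uz xz; apply: ker_trans xz (ker_upper_sub _) => /=.
      exact: same_block_trans uv.
    + by case=> z uz; exists z => //; apply: same_block_trans uv.
pose P z := connect (Gamma a a) (inr x) (inr z).
apply: (@connect_ind _ _ P) xy => [u v xu /orP[uv|uv]|]; last exact: connect0.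
  by apply: connect_trans xu _; apply: (@lower_edge (inl u) (inl v)).
by apply: connect_trans xu _; apply: (@upper_edge (inr u) (inr v)).
Qed.

Lemma same_block_mul b u v :
  same_block (diagram_mul a b) u v = joined a b u v.
Proof. exact: (same_block_of_rel (@joined_equiv n a b)). Qed.

Definition transversals_in_classes :=
  forall x y, same_block a (inl x) (inr y) -> ker a x y.

Definition transversal_unique_in_class :=
  forall x z y w, same_block a (inl x) (inr z) -> same_block a (inl y) (inr w) ->
    ker a z w -> same_block a (inl x) (inl y).

(** If [a] is idempotent and [x ~ y'], the product also joins [x] to [y'], which
    connects the middle vertices [x''] and [y''] and so relates [x] and [y] in
    [ker a]; and two transversal blocks over one kernel-class are merged in the
    product.  Conversely, under the two conditions all outer vertices on
    a path in [Gamma a a] lie in one block of [a]. *)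
Lemma idempotentP :
  Defs.idempotent a <-> transversals_in_classes /\ transversal_unique_in_class.
Proof.
split=> [/eqP idem_a | [T1 T2]].
  have sbE u v : same_block a u v = joined a a u v by rewrite -same_block_mul idem_a.
  split=> [x y xy | x z y w xz yw zw].
    rewrite ker_sym -connect_middle.
    apply: connect_trans (_ : connect _ _ (inl (inl x))) _.
      by apply: (@upper_edge (inr y) (inl x)); rewrite same_block_sym.
    apply: connect_trans (_ : connect _ _ (inl (inr y))) _; first by rewrite sbE in xy.
    by apply: (@lower_edge (inr y) (inl x)); rewrite same_block_sym.
  rewrite sbE; apply: connect_trans (@upper_edge (inl x) (inr z) xz) _.
  apply: connect_trans (_ : connect _ _ (inr w)) _; first by rewrite connect_middle.
  by apply: (@upper_edge (inr w) (inl y)); rewrite same_block_sym.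
apply/eqP; apply: eq_diagram => u v; rewrite same_block_mul.
apply/idP/idP=> [| uv].
  (* A middle vertex reached from [u] must lie in the kernel-class of the unique
     transversal block there, and this block must be the one of [u]. *)
  pose P p := match p with
    | inl v => same_block a u v : Prop
    | inr q => exists x y, [/\ same_block a (inl x) (inr y), same_block a u (inl x)
                             & ker a x q]
    end.
  move=> uv; suff: P (inl v) by [].
  apply: Gamma_ind uv => [w1 w2|w1 w2|]; last exact: same_block_refl.
  - case: w1 w2 => x [] y xy /=.
    + by move=> ux; apply: same_block_trans xy.
    + by move=> ux; exists x, y; split=> //; apply: T1.
    + case=> x1 [y1 [xy1 ux1 x1x]]; apply: same_block_trans ux1 _.
      have yx : same_block a (inl y) (inr x) by rewrite same_block_sym.
      by apply: (T2 _ _ _ _ xy1 yx); apply: ker_trans x1x; rewrite ker_sym; apply: T1 xy1.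
    + case=> x1 [y1 [xy1 ux1 x1x]]; exists x1, y1; split=> //.
      by apply: ker_trans x1x (ker_lower_sub _).
  - case: w1 w2 => x [] y xy /=.
    + case=> x1 [y1 [xy1 ux1 x1x]]; exists x1, y1; split=> //.
      by apply: ker_trans x1x (ker_upper_sub _).
    + case=> x1 [y1 [xy1 ux1 x1x]]; apply: same_block_trans ux1 _.
      apply: same_block_trans (xy); apply: (T2 _ _ _ _ xy1 xy).
      apply: ker_trans (T1 _ _ xy); apply: ker_trans x1x.
      by rewrite ker_sym; apply: T1 xy1.
    + move=> ux; exists y, x; split; last exact: ker_refl.
        by rewrite same_block_sym.
      exact: same_block_trans xy.
    + by move=> ux; apply: same_block_trans xy.
rewrite /joined /=.
have through x y : same_block a (inl x) (inr y) ->
    connect (Gamma a a) (inl (inl x)) (inl (inr y)).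
  move=> xy; apply: connect_trans (@upper_edge (inl x) (inr y) xy) _.
  apply: connect_trans (_ : connect _ _ (inr x)) _.
    by rewrite connect_middle ker_sym T1.
  exact: (@lower_edge (inl x) (inr y)).
case: u v uv => x [] y xy.
- exact: (@upper_edge (inl x) (inl y)).
- exact: through.
- by rewrite (sym_connect_sym (@Gamma_sym n a a)) through // same_block_sym.
- exact: (@lower_edge (inr x) (inr y)).
Qed.

End Idempotent.

Definition transversals n (a : diagram n) : {set {set vertex n}} :=
  [set B in blocks a | [exists x, inl x \in B] && [exists x, inr x \in B]].

(** There is a single kernel-class, so at most one transversal block. *)
Lemma rank_irreducible_idempotent n (a : diagram n) :
  irreducible a -> Defs.idempotent a -> rank a <= 1.
Proof.
move=> /forallP irr_a /idempotentP[_ T2]; apply/card_le1_eqP=> B C.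
rewrite !inE => /and3P[/mem_blocksP[u ->] /existsP[x Bx] /existsP[z Bz]].
move=> /and3P[/mem_blocksP[v ->] /existsP[y Cy] /existsP[w Cw]].
rewrite !inE in Bx Bz Cy Cw.
have xz : same_block a (inl x) (inr z).
  by apply: same_block_trans Bz; rewrite same_block_sym.
have yw : same_block a (inl y) (inr w).
  by apply: same_block_trans Cw; rewrite same_block_sym.
have xy := T2 _ _ _ _ xz yw (forallP (irr_a z) w).
have uv : same_block a u v.
  by apply: same_block_trans Bx _; apply: same_block_trans xy _; rewrite same_block_sym.
apply/setP=> p; rewrite !inE; apply/idP/idP; first exact: same_block_trans.
by apply: same_block_trans; rewrite same_block_sym.
Qed.

(** * Restricting and gluing along a decomposition of the vertices *)

Definition vertex_map m n (f : 'I_m -> 'I_n) (u : vertex m) : vertex n :=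
  match u with inl x => inl (f x) | inr x => inr (f x) end.

(** The three monoids differ only in the block sizes that they allow, which
    makes membership compatible with restriction and gluing. *)
Definition block_size_ok (K : diagram_family) : pred nat :=
  match K with
  | PartitionMonoid => predT
  | BrauerMonoid => eq_op^~ 2
  | PartialBrauerMonoid => leq^~ 2
  end.

Lemma mem_diagram_monoid K n (a : diagram n) :
  (a \in diagram_monoid K n) = [forall B in blocks a, block_size_ok K #|B|].
Proof. by case: K; rewrite inE //; apply/esym/forallP => B; apply/implyP. Qed.

(** The maps [h i] decompose ['I_n] into pieces indexed by [I], the piece [i]
    being a copy of ['I_(m i)].  They will come from bijections [g] as above, so
    each [h i] may be any bijection onto its piece. *)
Section Coordinates.

Variables (I : finType) (m : I -> nat) (n : nat).
Variable h : forall i, 'I_(m i) -> 'I_n.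
Hypothesis h_inj : forall i, injective (h (i := i)).
Hypothesis h_disjoint : forall i j x y, h (i := i) x = h (i := j) y -> i = j.
Hypothesis h_onto : forall y, exists i x, y = h (i := i) x.

Local Notation V i := (vertex_map (h (i := i))).

Lemma vertex_map_inj i : injective (V i).
Proof. by case=> x [] y //= [] /h_inj ->. Qed.

Lemma vertex_map_disjoint i j u v : V i u = V j v -> i = j.
Proof. by case: u v => x [] y //= [] /h_disjoint. Qed.

Lemma vertex_map_onto v : exists i u, v = V i u.
Proof.
by case: v => x; have [i [y ->]] := h_onto x; exists i; [exists (inl y)|exists (inr y)].
Qed.

Lemma restrict_equiv (a : diagram n) i :
  {in [set: vertex (m i)] & &,
     equivalence_rel (fun u v => same_block a (V i u) (V i v))}.
Proof.
move=> u v w _ _ _.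
by have [] := same_block_equiv a (in_setT (V i u)) (in_setT (V i v)) (in_setT (V i w)).
Qed.

Definition restrict (a : diagram n) i : diagram (m i) :=
  diagram_of_rel (restrict_equiv a (i := i)).

Lemma same_block_restrict a i u v :
  same_block (restrict a i) u v = same_block a (V i u) (V i v).
Proof. exact: same_block_of_rel. Qed.

(** Equivalently, [a] is the disjoint union of its restrictions. *)
Definition separated (a : diagram n) :=
  forall i j u v, same_block a (V i u) (V j v) -> i = j.

Lemma restrict_inj a b : separated a -> separated b ->
  (forall i, restrict a i = restrict b i) -> a = b.
Proof.
move=> sep_a sep_b eq_ab; apply: eq_diagram => u v.
have [i [{}u ->]] := vertex_map_onto u; have [j [{}v ->]] := vertex_map_onto v.
have [eij | nij] := eqVneq i j; last first.
  by apply/idP/idP=> [/sep_a|/sep_b] eij; rewrite eij eqxx in nij.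
by case: j / eij v => v; rewrite -!same_block_restrict eq_ab.
Qed.

(** The restrictions of a separated diagram can be prescribed independently. *)
Section Glue.
Variable b : forall i, diagram (m i).

Definition glue_rel : rel (vertex n) := [rel p q |
  [exists i, exists u, exists v, [&& p == V i u, q == V i v & same_block (b i) u v]]].

Lemma glue_relP p q :
  reflect (exists i u v, [/\ p = V i u, q = V i v & same_block (b i) u v])
          (glue_rel p q).
Proof.
apply: (iffP existsP) => [[i /existsP[u /existsP[v /and3P[/eqP pu /eqP qv uv]]]]|].
  by exists i, u, v.
case=> i [u [v [-> -> uv]]]; exists i; apply/existsP; exists u; apply/existsP.
by exists v; rewrite !eqxx.
Qed.

Lemma glue_relE i u v : glue_rel (V i u) (V i v) = same_block (b i) u v.
Proof.
apply/glue_relP/idP => [[j [u' [v' [eu]]]]|uv]; last by exists i, u, v.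
have ij := vertex_map_disjoint eu; case: j / ij u' v' eu => u' v'.
by move=> /vertex_map_inj -> /vertex_map_inj ->.
Qed.

Lemma glue_rel_separated i j u v : glue_rel (V i u) (V j v) -> i = j.
Proof.
by case/glue_relP=> k [u' [v' [/vertex_map_disjoint -> /vertex_map_disjoint ->]]].
Qed.

Lemma glue_equiv : {in [set: vertex n] & &, equivalence_rel glue_rel}.
Proof.
move=> p q s _ _ _.
have [i [u ->]] := vertex_map_onto p; have [j [v ->]] := vertex_map_onto q.
have [k [w ->]] := vertex_map_onto s; rewrite glue_relE same_block_refl; split=> // uv.
have ij := glue_rel_separated uv; case: j / ij v uv => v; rewrite glue_relE => uv.
apply/idP/idP => uw; have ik := glue_rel_separated uw.
  case: k / ik w uw => w; rewrite !glue_relE; apply: same_block_trans.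
  by rewrite same_block_sym.
by case: k / ik w uw => w; rewrite !glue_relE; apply: same_block_trans.
Qed.

Definition glue : diagram n := diagram_of_rel glue_equiv.

Lemma glue_separated : separated glue.
Proof. by move=> i j u v; rewrite same_block_of_rel => /glue_rel_separated. Qed.

Lemma restrict_glue i : restrict glue i = b i.
Proof.
apply: eq_diagram => u v.
by rewrite same_block_restrict same_block_of_rel glue_relE.
Qed.

End Glue.

Section Separated.
Variable a : diagram n.
Hypothesis sep_a : separated a.

Lemma ker_restrict i x y : ker (restrict a i) x y = ker a (h x) (h y).
Proof.
apply/idP/idP => [|xy].
  apply: (@connect_ind _ _ (fun y => ker a (h x) (h y))); last exact: ker_refl.
  move=> y1 y2 xy1 /orP[] /=; rewrite /ker_upper /ker_lower /= same_block_restrict => y12.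
    by apply: ker_trans xy1 _; apply: ker_upper_sub.
  by apply: ker_trans xy1 _; apply: ker_lower_sub.
pose P z := exists2 y, z = h y & ker (restrict a i) x y.
suff: P (h y) by case=> y' /h_inj ->.
apply: (@connect_ind _ _ P) xy; last by exists x; rewrite ?ker_refl.
move=> _ z [y1 -> xy1]; have [j [y2 ->]] := h_onto z => /orP[] /= y12.
- have ij := @sep_a _ _ (inl y1) (inl y2) y12.
  case: j / ij y2 y12 => y2 y12; exists y2 => //; apply: ker_trans xy1 _.
  by apply: ker_upper_sub; rewrite /ker_upper /= same_block_restrict.
- have ij := @sep_a _ _ (inr y1) (inr y2) y12.
  case: j / ij y2 y12 => y2 y12; exists y2 => //; apply: ker_trans xy1 _.
  by apply: ker_lower_sub; rewrite /ker_lower /= same_block_restrict.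
Qed.

Lemma ker_separated i j (x : 'I_(m i)) (y : 'I_(m j)) : ker a (h x) (h y) -> i = j.
Proof.
move=> xy; pose P z := exists y' : 'I_(m i), z = h y'.
suff: P (h y) by case=> y' /h_disjoint.
apply: (@connect_ind _ _ P) xy; last by exists x.
move=> _ z [y1 ->]; have [k [y2 ->]] := h_onto z => /orP[] /= y12.
  by have ik := @sep_a _ _ (inl y1) (inl y2) y12; case: k / ik y2 y12 => y2; exists y2.
by have ik := @sep_a _ _ (inr y1) (inr y2) y12; case: k / ik y2 y12 => y2; exists y2.
Qed.

(** No kernel-class of a separated diagram meets two pieces, and inside a piece
    the kernel is that of the restriction. *)
Lemma irreducible_restrictP :
  (forall i, irreducible (restrict a i)) <->
  (forall i j (x : 'I_(m i)) (y : 'I_(m j)), ker a (h x) (h y) = (i == j)).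
Proof.
split=> [irr i j x y | kerE i].
  apply/idP/eqP=> [/ker_separated // | ij]; case: j / ij y => y.
  by rewrite -ker_restrict; have /forallP/(_ x)/forallP := irr i.
by apply/forallP=> x; apply/forallP=> y; rewrite ker_restrict kerE.
Qed.

(** Both conditions of [idempotentP] only involve vertices of one piece, because
    blocks and kernel-classes do. *)
Lemma idempotent_restrictP :
  (forall i, Defs.idempotent (restrict a i)) <-> Defs.idempotent a.
Proof.
split=> [idem | /idempotentP[T1 T2] i].
  apply/idempotentP; split=> [x y | x z y w].
    have [i [{}x ->]] := h_onto x; have [j [{}y ->]] := h_onto y => xy.
    have ij := @sep_a _ _ (inl x) (inr y) xy; case: j / ij y xy => y xy.
    have /idempotentP[T1 _] := idem i; rewrite -ker_restrict.
    by apply: T1; rewrite same_block_restrict.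
  have [i [{}x ->]] := h_onto x; have [j [{}y ->]] := h_onto y.
  have [k [{}z ->]] := h_onto z; have [l [{}w ->]] := h_onto w => xz yw zw.
  have ik := @sep_a _ _ (inl x) (inr z) xz; case: k / ik z xz zw => z xz zw.
  have jl := @sep_a _ _ (inl y) (inr w) yw; case: l / jl w yw zw => w yw zw.
  have ij := ker_separated zw; case: j / ij y w yw zw => y w yw zw.
  have /idempotentP[_ T2] := idem i.
  rewrite -ker_restrict in zw; have := T2 x z y w; rewrite !same_block_restrict.
  exact.
apply/idempotentP; split=> [x y | x z y w].
  by rewrite same_block_restrict ker_restrict; apply: T1.
by rewrite !same_block_restrict ker_restrict; apply: T2.
Qed.

(** The blocks of a separated diagram are the images of the blocks of its
    restrictions ([blocks_push]); this is how sizes and ranks are compared. *)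
Definition push_block i (B : {set vertex (m i)}) : {set vertex n} :=
  [set V i u | u in B].

Lemma push_block_of_vertex i u :
  push_block [set v | same_block (restrict a i) u v]
    = [set v | same_block a (V i u) v].
Proof.
apply/setP=> w; rewrite inE; apply/imsetP/idP => [[v] /=|uw].
  by rewrite inE same_block_restrict => uv ->.
have [j [v def_w]] := vertex_map_onto w; rewrite {}def_w {w} in uw *.
have ij := sep_a uw; case: j / ij v uw => v uw.
by exists v => //=; rewrite inE same_block_restrict.
Qed.

Lemma blocks_push B :
  B \in blocks a <->
  exists i, exists2 C, C \in blocks (restrict a i) & B = push_block C.
Proof.
split=> [/mem_blocksP[w ->]|[i [_ /mem_blocksP[u ->] ->]]].
  have [i [u ->]] := vertex_map_onto w; exists i; rewrite -push_block_of_vertex.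
  by eexists; last reflexivity; apply/mem_blocksP; exists u.
by apply/mem_blocksP; exists (V i u); rewrite push_block_of_vertex.
Qed.

Lemma card_push_block i (B : {set vertex (m i)}) : #|push_block B| = #|B|.
Proof. by rewrite card_imset //; apply: vertex_map_inj. Qed.

Lemma mem_monoid_restrict K :
  (a \in diagram_monoid K n) = [forall i, restrict a i \in diagram_monoid K (m i)].
Proof.
rewrite mem_diagram_monoid; apply/forall_inP/forallP => [ok i | ok B].
  rewrite mem_diagram_monoid; apply/forall_inP=> B aB.
  by rewrite -card_push_block; apply: ok; apply/blocks_push; exists i, B.
case/blocks_push=> i [C aC ->]; rewrite card_push_block.
by have := ok i; rewrite mem_diagram_monoid => /forall_inP; apply.
Qed.

Lemma mem_transversals_push i (B : {set vertex (m i)}) :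
    B \in blocks (restrict a i) ->
  (push_block B \in transversals a) = (B \in transversals (restrict a i)).
Proof.
move=> aB; rewrite !inE aB (_ : push_block B \in blocks a); last first.
  by apply/blocks_push; exists i, B.
congr (_ && (_ && _)); apply/existsP/existsP => [[x /imsetP[[] y By] //] | [x Bx]].
- by exists y.
- by exists (h x); apply: (@imset_f _ _ (V i) _ (inl x)).
- by exists y.
- by exists (h x); apply: (@imset_f _ _ (V i) _ (inr x)).
Qed.

Lemma rank_restrict : rank a = \sum_i rank (restrict a i).
Proof.
pose T i : {set {set vertex (m i)}} := transversals (restrict a i).
pose push (p : {i & {set vertex (m i)}}) := push_block (tagged p).
pose P := [set p : {i & {set vertex (m i)}} | tagged p \in T (tag p)].
rewrite -[rank a]/#|transversals a|.
have -> : \sum_i rank (restrict a i) = #|P|.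
  rewrite -sum1dep_card -(sig_big_dep predT (fun i => mem (T i)) (fun=> fun=> 1)).
  by apply: eq_bigr => i _; rewrite sum1_card.
have push_inj : {in P &, injective push}.
  move=> [i B] [j C]; rewrite !inE /push /= => /andP[/mem_blocksP[u defB] _] _ eqBC.
  have /imsetP[v _ /vertex_map_disjoint ij] : V i u \in push_block C.
    by rewrite -eqBC; apply: imset_f; rewrite defB inE same_block_refl.
  case: j / ij C v eqBC => C v eqBC.
  by congr Tagged; apply: imset_inj eqBC; apply: vertex_map_inj.
rewrite -(card_in_imset push_inj).
apply: eq_card => B; apply/idP/imsetP => [aB|[[i C]]].
  have [i [C aC defB]] :
      exists i, exists2 C, C \in blocks (restrict a i) & B = push_block C.
    by apply/blocks_push; have := aB; rewrite inE => /andP[].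
  exists (Tagged (fun i => {set vertex (m i)}) C) => //.
  by rewrite inE /= /T -mem_transversals_push -?defB.
rewrite inE /= => aC ->; rewrite /push mem_transversals_push //=.
by move: aC; rewrite inE => /andP[].
Qed.

End Separated.
End Coordinates.

(** * Idempotents with prescribed kernel-classes *)

Section Families.
Variables (I : finType) (m : I -> nat) (K : diagram_family).

Definition irreducible_idempotents r i : {set diagram (m i)} :=
  [set a in diagram_monoid K (m i) | [&& irreducible a, Defs.idempotent a & rank a == r]].

Definition summand i : {set diagram (m i)} :=
  [set a in diagram_monoid K (m i) | irreducible a && Defs.idempotent a].

Definition summand_families r : {set {dffun forall i, diagram (m i)}} :=
  [set b : {dffun forall i, diagram (m i)} |
     [forall i, b i \in summand i] && (\sum_i rank (b i) == r)].

(** Each member of a family has rank 0 or 1, so the rank of the family is the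
    number of indices [i] in the set [A] where the rank is 1; for a fixed [A] the
    members are chosen independently. *)
Lemma card_summand_families r :
  #|summand_families r| =
    \sum_(A : {set I} | #|A| == r)
      ((\prod_(i in A) c 1 (diagram_monoid K (m i))) *
       (\prod_(i in ~: A) c 0 (diagram_monoid K (m i)))).
Proof.
pose A_of (b : {dffun forall i, diagram (m i)}) := [set i | rank (b i) == 1].
have rank_b (b : {dffun forall i, diagram (m i)}) i :
    [forall i, b i \in summand i] -> rank (b i) = (i \in A_of b).
  move=> /forallP/(_ i); rewrite !inE => /and3P[_ irr idem].
  by have := rank_irreducible_idempotent irr idem; case: (rank _) => [|[]].
have sum_rank (b : {dffun forall i, diagram (m i)}) :
    [forall i, b i \in summand i] -> \sum_i rank (b i) = #|A_of b|.
  move=> /rank_b rk; under eq_bigr => i _ do rewrite rk.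
  by rewrite -sum1_card [RHS]big_mkcond; apply: eq_bigr => i _; case: (_ \in _).
rewrite -sum1dep_card (partition_big A_of (fun A => #|A| == r)) /=; last first.
  by move=> b /andP[bS]; rewrite sum_rank.
apply: eq_bigr => A /eqP cardA.
pose F i : pred (diagram (m i)) := mem (irreducible_idempotents (i \in A) i).
rewrite (eq_bigl (fun b => b \in family F)); last first.
  move=> b; apply/andP/familyP => [[/andP[bS _] /eqP defA] i | bF].
    move/forallP/(_ i): (bS); rewrite !inE => /and3P[-> -> ->] /=.
    by rewrite (rank_b b i bS) defA.
  have bS : [forall i, b i \in summand i].
    by apply/forallP=> i; have := bF i; rewrite !inE => /and4P[-> -> ->].
  have defA : A_of b = A.
    apply/setP=> i; have := bF i; rewrite !inE => /and4P[_ _ _ /eqP->].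
    by case: (i \in A).
  by rewrite bS sum_rank // defA cardA !eqxx.
rewrite [LHS](_ : _ =
    #|(family F : simpl_pred {dffun forall i, diagram (m i)})|); last first.
  by rewrite -sum1_card; apply: eq_bigl.
rewrite card_family foldrE big_map big_enum /=.
rewrite (bigID (mem A)) /=; congr (_ * _).
  by apply: eq_bigr => i iA; rewrite /F iA.
by apply: eq_big => [i|i /negPf iA]; rewrite ?inE // /F iA.
Qed.

End Families.

Section CountAdapted.
Variables (I : finType) (m : I -> nat) (n : nat) (K : diagram_family).
Variable h : forall i, 'I_(m i) -> 'I_n.
Hypothesis h_inj : forall i, injective (h (i := i)).
Hypothesis h_disjoint : forall i j x y, h (i := i) x = h (i := j) y -> i = j.
Hypothesis h_onto : forall y, exists i x, y = h (i := i) x.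

Definition ker_adapted (a : diagram n) : bool :=
  [forall i, forall j, forall x : 'I_(m i), forall y : 'I_(m j),
     ker a (h x) (h y) == (i == j)].

Lemma ker_adaptedP a :
  reflect (forall i j (x : 'I_(m i)) (y : 'I_(m j)), ker a (h x) (h y) = (i == j))
          (ker_adapted a).
Proof.
apply: (iffP idP) => [kerE i j x y | kerE].
  by apply/eqP; have /forallP/(_ i)/forallP/(_ j)/forallP/(_ x)/forallP := kerE.
by do 4!apply/forallP=> ?; rewrite kerE.
Qed.

(** Kernels always keep upper blocks together and lower blocks together; for
    transversal blocks idempotency is what makes them stay in one piece. *)
Lemma separated_of_adapted a :
  Defs.idempotent a -> ker_adapted a -> separated h a.
Proof.
move=> /idempotentP[T1 _] /ker_adaptedP kerE i j [] x [] y /= xy;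
  apply/eqP; rewrite -(kerE i j x y).
- exact: ker_upper_sub.
- exact: T1.
- by rewrite ker_sym T1 // same_block_sym.
- exact: ker_lower_sub.
Qed.

(** Restriction to the pieces is a bijection, with [glue] as its inverse; the
    right-hand side does not depend on [h]. *)
Lemma card_adapted r :
  #|[set a in D r K n | Defs.idempotent a && ker_adapted a]|
    = #|summand_families m K r|.
Proof.
pose res (a : diagram n) : {dffun forall i, diagram (m i)} :=
  [ffun i => restrict h a i].
have sepP a :
    a \in [set a in D r K n | Defs.idempotent a && ker_adapted a] -> separated h a.
  by rewrite inE => /and3P[_ ? ?]; apply: separated_of_adapted.
rewrite -(card_in_imset (f := res)); last first.
  move=> a b /sepP sep_a /sepP sep_b /ffunP eq_ab.
  by apply: (restrict_inj h_onto sep_a sep_b) => i; have := eq_ab i; rewrite !ffunE.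
have memE a : separated h a ->
    (a \in [set a in D r K n | Defs.idempotent a && ker_adapted a])
    = (res a \in summand_families m K r).
  move=> sep_a; rewrite !inE (mem_monoid_restrict h_inj h_onto sep_a).
  rewrite (rank_restrict h_inj h_disjoint h_onto sep_a).
  rewrite (eq_bigr (fun i => rank (res a i))); last by move=> i _; rewrite ffunE.
  have idemE := idempotent_restrictP h_inj h_disjoint h_onto sep_a.
  have irrE := irreducible_restrictP h_inj h_disjoint h_onto sep_a.
  apply/idP/idP=> [/and3P[/andP[/forallP monK ->] idem /ker_adaptedP kerE] | ].
    rewrite andbT; apply/forallP=> i; rewrite inE ffunE monK /=.
    by rewrite (irrE.2 kerE) (idemE.2 idem).
  case/andP=> /forallP resS ->; rewrite andbT; apply/and3P; split.
  - by apply/forallP=> i; have := resS i; rewrite ffunE inE => /andP[].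
  - by apply/idemE=> i; have := resS i; rewrite ffunE inE => /and3P[].
  - by apply/ker_adaptedP/irrE => i; have := resS i; rewrite ffunE inE => /and3P[].
apply: eq_card => b; apply/imsetP/idP => [[a aS ->] | bS].
  by rewrite -memE //; apply: sepP.
pose a := glue h_inj h_disjoint h_onto b.
have sep_a : separated h a by apply: glue_separated.
have res_a : res a = b by apply/ffunP=> i; rewrite ffunE restrict_glue.
by exists a; rewrite ?memE // res_a.
Qed.

End CountAdapted.

(** * Injections over a base set *)

Section InjectionsOver.
Variables (T I : finType) (q : T -> I).

(** The values chosen for positions with the same label [i] are distinct elements
    of the fibre of [q] over [i], whereas different fibres do not interact: each
    label contributes a falling factorial. *)
Lemma card_uniq_tuples_over n (D : pred T) (w : n.-tuple I) :
  #|[set t : n.-tuple T | [&& all D t, uniq t & map q t == w]]|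
    = \prod_i #|[pred x | D x & q x == i]| ^_ (count_mem i w).
Proof.
elim: n => [|n IHn] in D w *.
  rewrite [w]tuple0 big1 => [|i _]; last by rewrite ffactn0.
  by rewrite (@eq_card1 _ [tuple]) // => t; rewrite [t]tuple0 !inE !eqxx.
case/tupleP: w => i0 w; pose d i := #|[pred x | D x & q x == i]|.
rewrite -sum1dep_card.
rewrite (partition_big (@thead _ _) [pred x | D x & q x == i0]) /= => [|t]; last first.
  by case/tupleP: t => x t; rewrite theadE /= => /and3P[/andP[-> _] _ /eqP[->]] /=.
transitivity (\sum_(x | D x && (q x == i0))
   (d i0).-1 ^_ (count_mem i0 w) * \prod_(i | i != i0) d i ^_ (count_mem i w)).
  apply: eq_bigr => x /andP[Dx /eqP qx].
  rewrite (reindex (fun t : n.-tuple T => [tuple of x :: t])) /=; last first.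
    pose ttail (t : n.+1.-tuple T) := [tuple of behead t].
    exists ttail => [t _ | t /andP[_ /eqP <-]]; first exact: val_inj.
    by rewrite -tuple_eta.
  transitivity #|[set t : n.-tuple T | [&& all [predD1 D & x] t, uniq t & map q t == w]]|.
    rewrite -sum1dep_card; apply: eq_bigl => t.
    rewrite theadE eqxx andbT Dx qx eqseq_cons eqxx /=.
    rewrite all_predI all_predC has_pred1.
    by rewrite -!andbA andbCA.
  rewrite IHn (bigD1 i0) //=; congr (_ ^_ _ * _).
    rewrite /d [in RHS](cardD1 x) inE Dx qx eqxx /=.
    by apply: eq_card => y; rewrite !inE andbA.
  apply: eq_bigr => i ii0; congr (_ ^_ _); apply: eq_card => y; rewrite !inE -andbA.
  by case: eqVneq => //= ->; rewrite qx eq_sym (negPf ii0) andbF.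
rewrite sum_nat_const [in RHS](bigD1 i0) //= eqxx add1n mulnA; congr (_ * _).
by apply: eq_bigr => i /negPf ii0; rewrite eq_sym ii0.
Qed.

Lemma card_injections_over (X : finType) (p : X -> I) (D : pred T) :
  #|[set f : {ffun X -> T} |
      [&& injectiveb f, [forall x, D (f x)] & [forall x, q (f x) == p x]]]|
    = \prod_i #|[pred x | D x & q x == i]| ^_ #|[pred x | p x == i]|.
Proof.
have sizew : size (map p (enum X)) == #|X| by rewrite size_map -cardE.
have bijFF: {on (_ : pred _), bijective (@Finfun X T)}.
  by exists fgraph => x _; [apply: FinfunK | apply: fgraphK].
transitivity (\prod_i #|[pred x | D x & q x == i]| ^_ (count_mem i (Tuple sizew)));
  last first.
  apply: eq_bigr => i _; congr (_ ^_ _).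
  by rewrite /= count_map enumT [RHS]cardE /enum_mem size_filter.
rewrite -card_uniq_tuples_over.
rewrite -(on_card_preimset (bijFF _)); apply: eq_card => /= t.
set f := Finfun t; have ft : tval t = codom f by rewrite codom_ffun FinfunK.
rewrite !inE ft andbCA; congr [&& _, _ & _].
- apply/forallP/allP => [Df _ /codomP[x ->] // | Df x].
  by apply: Df; apply: codom_f.
- apply/forallP/eqP => [qf | /= qf x].
    by rewrite /= codomE -map_comp; apply: eq_map => x; apply/eqP/qf.
  move: qf; rewrite codomE -map_comp => /eq_in_map/(_ x); rewrite mem_enum /=.
  by move=> ->.
Qed.

End InjectionsOver.

(** * Coordinates adapted to a set partition *)

(** Coordinates for a set partition [P] are bijections [g] under which the blocks
    of [P] become the fibres of [tag].  Such a [g] amounts to a labelling of the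
    blocks by [I] that respects sizes, given by [cell g], together with a
    numbering of the elements of each block. *)
Section CoordinatesOfPartition.

Variables (T : finType) (P : {set {set T}}).
Hypothesis partP : partition P [set: T].
Variables (I : finType) (m : I -> nat).
Hypothesis m_gt0 : forall i, 0 < m i.

Local Notation X := {i : I & 'I_(m i)}.
Hypothesis cardX : #|{: X}| = #|T|.

Definition coordinates : {set {ffun X -> T}} :=
  [set g : {ffun X -> T} | injectiveb g &
     [forall x, forall y, (pblock P (g x) == pblock P (g y)) == (tag x == tag y)]].

Definition labelings : {set {ffun I -> {set T}}} :=
  [set s : {ffun I -> {set T}} |
     [&& injectiveb s, [forall i, s i \in P] & [forall i, #|s i| == m i]]].

Definition cell (g : {ffun X -> T}) : {ffun I -> {set T}} :=
  [ffun i => [set g x | x in [pred x | tag x == i]]].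

Lemma card_fiber i : #|[pred x : X | tag x == i]| = m i.
Proof.
pose inX j (x : 'I_(m j)) : X := Tagged (fun i => 'I_(m i)) x.
rewrite -[RHS]card_ord -(card_imset (f := inX i)).
  apply: eq_card => -[j x]; rewrite !inE /=; apply/eqP/imsetP => [ij|[y _]].
    by case: i / ij => //; exists x.
  by move=> /(congr1 tag).
by move=> x y /eqP; rewrite eq_Tagged => /eqP.
Qed.

Lemma mem_pblockT x : x \in pblock P x.
Proof. by have /and3P[/eqP cov _ _] := partP; rewrite mem_pblock cov inE. Qed.

Lemma pblock_memT x : pblock P x \in P.
Proof. by have /and3P[/eqP cov _ _] := partP; rewrite pblock_mem // cov inE. Qed.

Lemma pblock_eqT x B : B \in P -> x \in B -> pblock P x = B.
Proof. by have /and3P[_ tiP _] := partP; apply: def_pblock. Qed.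

Lemma pblock_eqE x y : (pblock P x == pblock P y) = (y \in pblock P x).
Proof.
have /and3P[/eqP cov tiP _] := partP.
by rewrite eq_pblock // cov inE.
Qed.

Lemma bij_of_inj (g : {ffun X -> T}) : injective g -> forall y, exists x, y = g x.
Proof.
move=> g_inj y; have /codomP[x ->] : y \in codom g.
  by apply: inj_card_onto; rewrite ?cardX.
by exists x.
Qed.

Lemma coordinatesP (g : {ffun X -> T}) :
  reflect (injective g /\
           forall x y, (pblock P (g x) == pblock P (g y)) = (tag x == tag y))
          (g \in coordinates).
Proof.
rewrite inE; apply: (iffP andP) => -[/injectiveP g_inj gP]; split=> //.
  by move=> x y; apply: (eqP (forallP (forallP gP x) y)).
by apply/forallP=> x; apply/forallP=> y; rewrite gP.
Qed.

Lemma cell_pblock (g : {ffun X -> T}) x :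
  g \in coordinates -> cell g (tag x) = pblock P (g x).
Proof.
case/coordinatesP=> g_inj gP; apply/setP=> y; rewrite ffunE.
apply/imsetP/idP => [[z zx ->]|].
  by rewrite -pblock_eqE gP eq_sym.
have [z ->] := bij_of_inj g_inj y; rewrite -pblock_eqE gP => xz.
by exists z => //; rewrite inE eq_sym.
Qed.

Lemma cell_labeling (g : {ffun X -> T}) : g \in coordinates -> cell g \in labelings.
Proof.
move=> gC; have [g_inj gP] := coordinatesP _ gC; rewrite inE.
have ex_tag i : exists x : X, tag x = i.
  by exists (Tagged (fun i => 'I_(m i)) (Ordinal (m_gt0 i))).
apply/and3P; split.
- apply/injectiveP=> i j; have [x <-] := ex_tag i; have [y <-] := ex_tag j.
  by rewrite !cell_pblock // => /eqP; rewrite gP => /eqP.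
- by apply/forallP=> i; have [x <-] := ex_tag i; rewrite cell_pblock // pblock_memT.
- by apply/forallP=> i; rewrite ffunE card_imset // card_fiber.
Qed.

(** Given the labelling [s], the coordinates are the injections [g] whose value
    at [x] lies in the block [s (tag x)]: injections over the set of blocks. *)
Lemma coordinates_over s : s \in labelings ->
  #|[set g in coordinates | cell g == s]| = \prod_i (m i)`!.
Proof.
rewrite inE => /and3P[/injectiveP s_inj /forallP sP /forallP s_size].
transitivity #|[set g : {ffun X -> T} |
   [&& injectiveb g, [forall x : X, true] & [forall x, pblock P (g x) == s (tag x)]]]|.
  apply: eq_card => g; rewrite inE [RHS]inE; apply/idP/idP.
    case/andP=> gC /eqP <-; have := gC; rewrite inE => /andP[-> _].
    rewrite (_ : [forall x : X, true]) /=; last by apply/forallP.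
    by apply/forallP=> x; rewrite cell_pblock.
  case/and3P=> g_inj _ /forallP gs.
  have gC : g \in coordinates.
    apply/coordinatesP; split=> [|x y]; first exact/injectiveP.
    by rewrite (eqP (gs x)) (eqP (gs y)) (inj_eq s_inj).
  rewrite gC; apply/eqP/ffunP=> i.
  have <- : tag (Tagged (fun i => 'I_(m i)) (Ordinal (m_gt0 i))) = i by [].
  by rewrite cell_pblock // (eqP (gs _)).
rewrite (card_injections_over _ _ predT).
have s_fiber i : #|[pred x | true & pblock P x == s i]| = m i.
  rewrite -(eqP (s_size i)); apply: eq_card => x; rewrite inE /=.
  by apply/eqP/idP => [<-|]; [apply: mem_pblockT | apply: pblock_eqT].
rewrite (bigID (mem (s @: predT))) /= [X in _ * X]big1 ?muln1; last first.
  move=> B sB; rewrite [X in _ ^_ X](_ : _ = 0) ?ffactn0 //.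
  apply: eq_card0 => x; rewrite !inE /=; apply/eqP=> defB.
  by case/negP: sB; rewrite -defB imset_f.
rewrite big_imset /=; last by move=> i j _ _; apply: s_inj.
apply: eq_bigr => i _; rewrite s_fiber.
rewrite (_ : #|_| = m i) ?ffactnn // -card_fiber.
by apply: eq_card => x; rewrite !inE (inj_eq s_inj).
Qed.

Lemma card_coordinates : #|coordinates| = #|labelings| * \prod_i (m i)`!.
Proof.
rewrite -sum1_card (partition_big cell (mem labelings)) /=; last exact: cell_labeling.
rewrite -sum_nat_const; apply: eq_bigr => s sL.
by rewrite -(coordinates_over sL) sum1dep_card.
Qed.

(** A labelling is an injection from [I] to [P] over the set of possible sizes;
    as [P] and [m] have the same sizes, each falling factorial is a factorial. *)
Lemma card_labelings N : (forall i, m i <= N) ->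
    perm_eq [seq #|B : {set T}| | B in P] [seq m i | i : I] ->
  #|labelings| = \prod_(1 <= v < N.+1) (#|[pred i | m i == v]|)`!.
Proof.
move=> mN sizesP.
have sizeP B : B \in P -> #|B| <= N.
  move=> PB; have : #|B| \in [seq m i | i : I].
    by rewrite -(perm_mem sizesP); apply/imageP; exists B.
  by case/imageP=> i _ ->.
pose p i : 'I_N.+1 := inord (m i); pose q (B : {set T}) : 'I_N.+1 := inord #|B|.
transitivity #|[set s : {ffun I -> {set T}} |
   [&& injectiveb s, [forall i, s i \in P] & [forall i, q (s i) == p i]]]|.
  apply: eq_card => s; rewrite !inE; congr (_ && _).
  case sP: [forall i, s i \in P] => //=; apply: eq_forallb => i.
  by rewrite -val_eqE /= !inordK // ltnS ?mN ?sizeP // (forallP sP).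
rewrite card_injections_over.
have -> : \prod_(1 <= v < N.+1) #|[pred i | m i == v]|`!
    = \prod_(v < N.+1) #|[pred i | m i == v]|`!.
  (* No part has size 0, so this extra factor is [0`! = 1]. *)
  rewrite -(big_mkord predT (fun v => #|[pred i | m i == v]|`!)) [RHS]big_ltn //.
  rewrite [X in X`!]eq_card0 ?mul1n // => i.
  by rewrite !inE eqn0Ngt m_gt0.
apply: eq_bigr => v _.
have -> : #|[pred i | p i == v]| = #|[pred i | m i == v]|.
  by apply: eq_card => i; rewrite !inE -val_eqE /= inordK // ltnS mN.
have -> : #|[pred B | B \in P & q B == v]| = #|[pred i | m i == v]|; last exact: ffactnn.
transitivity (count_mem (val v) [seq #|B : {set T}| | B in P]).
  rewrite count_map -size_filter cardE /enum_mem -filter_predI; congr (size _).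
  apply: eq_filter => B; rewrite !inE /= andbC.
  case PB: (B \in P); rewrite ?andbF ?andbT //.
  by rewrite -val_eqE /= inordK // ltnS sizeP.
by rewrite (permP sizesP) count_map enumT [RHS]cardE /enum_mem size_filter.
Qed.

(** The cells of [g] are the blocks of [P], each listed once; so coordinates
    exist only if [P] has block sizes [m]. *)
Lemma perm_eq_of_coordinates (g : {ffun X -> T}) : g \in coordinates ->
  perm_eq [seq #|B : {set T}| | B in P] [seq m i | i : I].
Proof.
move=> gC; have := cell_labeling gC; rewrite inE.
case/and3P=> [/injectiveP s_inj /forallP sP /forallP s_size].
have [g_inj _] := coordinatesP _ gC.
have -> : [seq m i | i : I] = map (fun B : {set T} => #|B|) [seq cell g i | i : I].
  by rewrite -map_comp; apply: eq_map => i /=; rewrite (eqP (s_size i)).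
apply: perm_map; apply: uniq_perm; rewrite ?enum_uniq ?map_inj_uniq -?enumT ?enum_uniq //.
move=> B; rewrite mem_enum; apply/idP/mapP => [PB | [i _ ->] //].
have /and3P[_ _ P0] := partP; have /set0Pn[y By]: B != set0 by apply: contraNneq P0 => <-.
have [x def_y] := bij_of_inj g_inj y; exists (tag x); rewrite ?mem_enum //.
by rewrite cell_pblock // -def_y (pblock_eqT PB By).
Qed.

End CoordinatesOfPartition.

(** * The double count *)

Lemma prod_fact_count n (s : seq nat) : all (fun x => 0 < x <= n) s ->
  \prod_(x <- s) x`! = \prod_(1 <= v < n.+1) v`! ^ count_mem v s.
Proof.
elim: s => [_|x s IHs /= /andP[xn /IHs{}IHs]]; first by rewrite big_nil big1.
rewrite big_cons IHs.
under [RHS]eq_bigr => v _ do rewrite expnD.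
rewrite big_split; congr (_ * _).
rewrite (bigD1_seq x) ?iota_uniq ?mem_index_iota //= eqxx expn1 big1 ?muln1 //.
by move=> v /negPf vx; rewrite eq_sym vx.
Qed.

Section KernelType.
Variables (n : nat) (a : diagram n).

Lemma kernel_classes_partition : partition (kernel_classes a) [set: 'I_n].
Proof. by apply: equivalence_partitionP => x y z _ _ _; apply: ker_equiv. Qed.

Lemma pblock_kernel_classes x y :
  (pblock (kernel_classes a) x == pblock (kernel_classes a) y) = ker a x y.
Proof.
rewrite (pblock_eqE kernel_classes_partition).
by rewrite pblock_equivalence_partition ?inE // => ? ? ? _ _ _; apply: ker_equiv.
Qed.

Lemma mu_of_eqE (mu : intpart n) :
  (mu_of a == mu) = perm_eq [seq #|B : {set 'I_n}| | B in kernel_classes a] mu.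
Proof.
have /and3P[mu_sorted _ _] : is_intpart n mu by case: mu.
rewrite -val_eqE /= /kernel_sizes -(perm_sort geq); apply/eqP/idP => [-> //|].
move=> eq_mu; apply: (sorted_eq (leT := geq)) => //.
- by move=> x y z yx zx; apply: leq_trans zx yx.
- by move=> x y /andP[/= yx xy]; apply/eqP; rewrite eqn_leq xy yx.
- by apply: sort_sorted => x y; apply: leq_total.
Qed.

End KernelType.

Section DoubleCount.
Variables (K : diagram_family) (n r : nat) (mu : intpart n).

Let m (i : 'I_(size mu)) := nth 0 mu i.
Local Notation X := {i : 'I_(size mu) & 'I_(m i)}.

Lemma map_nth_parts : [seq m i | i : 'I_(size mu)] = mu.
Proof.
rewrite -[RHS](mkseq_nth 0) /mkseq -val_enum_ord -map_comp.
by apply: eq_map.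
Qed.

Lemma part_bounds x : x \in (mu : seq nat) -> 0 < x <= n.
Proof.
have /and3P[_ /allP mu_gt0 /eqP sum_mu] : is_intpart n mu by case: mu.
by move=> mux; rewrite mu_gt0 //= -[leqRHS]sum_mu sumnE (big_rem x) //= leq_addr.
Qed.

Lemma m_bounds i : 0 < m i <= n.
Proof. by apply/part_bounds/mem_nth. Qed.

Lemma m_gt0 i : 0 < m i.
Proof. by case/andP: (m_bounds i). Qed.

Lemma card_coordinate_type : #|{: X}| = #|'I_n|.
Proof.
have /and3P[_ _ /eqP sum_mu] : is_intpart n mu by case: mu.
rewrite card_tagged card_ord -[RHS]sum_mu -[in RHS]map_nth_parts.
by congr sumn; apply: eq_map => i; rewrite /= card_ord.
Qed.

Lemma card_parts_eq v : #|[pred i | m i == v]| = count_mem v mu.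
Proof.
by rewrite -[in RHS]map_nth_parts count_map enumT [LHS]cardE /enum_mem size_filter.
Qed.

(** For a set partition of type [mu], the number of ways to match its blocks with
    the parts of [mu] and to number the elements of each block. *)
Definition shape_symmetries :=
  \prod_(1 <= v < n.+1) ((count_mem v mu)`! * v`! ^ count_mem v mu).

Lemma card_coordinates_kernel (a : diagram n) :
  #|coordinates (kernel_classes a) m| = (mu_of a == mu) * shape_symmetries.
Proof.
have partP := kernel_classes_partition a.
case mu_a: (mu_of a == mu).
  rewrite (card_coordinates partP m_gt0 card_coordinate_type).
  rewrite (card_labelings m_gt0 (N := n)); last by rewrite map_nth_parts -mu_of_eqE.
    rewrite mul1n /shape_symmetries big_split; congr (_ * _).
      by apply: eq_bigr => v _; rewrite card_parts_eq.
    rewrite -prod_fact_count; last by apply/allP/part_bounds.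
    by rewrite -[in RHS]map_nth_parts big_map big_enum.
  by move=> i; case/andP: (m_bounds i).
apply: eq_card0 => g; apply/negP=> gC; move/idP: mu_a; apply.
rewrite mu_of_eqE -map_nth_parts.
by rewrite (perm_eq_of_coordinates partP m_gt0 card_coordinate_type gC).
Qed.

(** The same number for every [g]: its restrictions [h i] to the fibres of [tag]
    identify the kernel-classes with the ['I_(m i)]. *)
Lemma card_idempotents_adapted (g : {ffun X -> 'I_n}) : injective g ->
  #|[set a in D r K n | Defs.idempotent a && (g \in coordinates (kernel_classes a) m)]|
    = #|summand_families m K r|.
Proof.
move=> g_inj; pose h i (x : 'I_(m i)) := g (Tagged (fun i => 'I_(m i)) x).
have h_inj i : injective (h i) by move=> x y /g_inj/eqP; rewrite eq_Tagged => /eqP.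
have h_disjoint i j x y : h i x = h j y -> i = j by move=> /g_inj/(congr1 tag).
have h_onto y : exists i x, y = h i x.
  by have [[i x] ->] := bij_of_inj card_coordinate_type g_inj y; exists i, x.
rewrite -(card_adapted K h_inj h_disjoint h_onto).
apply: eq_card => a; rewrite inE [RHS]inE; congr [&& _, _ & _].
apply/coordinatesP/ker_adaptedP => [[_ gP] i j x y | gP].
  by rewrite -pblock_kernel_classes gP.
split=> // -[i x] [j y]; rewrite pblock_kernel_classes; exact: gP.
Qed.

(** Both sides count the pairs of an idempotent [a] and coordinates [g] for its
    kernel-classes: by [a] on the left, by [g] on the right. *)
Lemma e_mu_symmetries :
  e_mu mu (D r K n) * shape_symmetries = n`! * #|summand_families m K r|.
Proof.
pose S := [set a in D r K n | Defs.idempotent a].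
transitivity (\sum_(a in S) \sum_(g in coordinates (kernel_classes a) m) 1).
  under eq_bigr => a _ do rewrite sum1_card card_coordinates_kernel.
  rewrite -big_distrl; congr (_ * _).
  rewrite /e_mu -sum1dep_card [RHS]big_mkcond [LHS]big_mkcond; apply: eq_bigr => a _.
  by rewrite [in RHS]inE andbA; case: (_ && Defs.idempotent a) => //=; case: eqP.
rewrite (exchange_big_dep (fun g : {ffun X -> 'I_n} => injectiveb g)) /=; last first.
  by move=> a g _; rewrite inE => /andP[].
transitivity (\sum_(g : {ffun X -> 'I_n} | injectiveb g) #|summand_families m K r|).
  apply: eq_bigr => g /injectiveP g_inj.
  rewrite -(card_idempotents_adapted g_inj) -sum1dep_card; apply: eq_bigl => a.
  by rewrite inE andbA.
by rewrite sum_nat_cond_const card_inj_ffuns card_coordinate_type card_ord ffactnn.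
Qed.

End DoubleCount.

Import GRing.Theory.
Import Num.Theory.
Local Open Scope ring_scope.

Theorem theorem8 (K : diagram_family) (n r : nat) (hr : (r <= n)%N) :
  e (D r K n) = (\sum_(mu : intpart n) e_mu mu (D r K n))%N
  /\
  forall mu : intpart n,
    (e_mu mu (D r K n))%:R =
      (n`!)%:R
        / \prod_(1 <= i < n.+1) (((count_mem i mu)`!)%:R * (i`!)%:R ^+ count_mem i mu)
      * \sum_(A : {set 'I_(size mu)} | #|A| == r)
          ((\prod_(i in A) (c 1 (diagram_monoid K (nth 0%N mu i)))%:R)
           * (\prod_(j in ~: A) (c 0 (diagram_monoid K (nth 0%N mu j)))%:R))
      :> rat.
Proof.
split=> [|mu].
  rewrite /e -sum1dep_card (partition_big (@mu_of n) predT) //=.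
  apply: eq_bigr => mu _; rewrite sum1dep_card.
  by apply: eq_card => a; rewrite !inE andbA.
have symE : \prod_(1 <= i < n.+1) (((count_mem i mu)`!)%:R * (i`!)%:R ^+ count_mem i mu)
    = (shape_symmetries mu)%:R :> rat.
  by rewrite /shape_symmetries natr_prod; apply: eq_bigr => i _; rewrite natrM natrX.
have sym_neq0 : (shape_symmetries mu)%:R != 0 :> rat.
  rewrite pnatr_eq0 -lt0n /shape_symmetries; elim/big_ind: _ => // [x y|v _].
    by rewrite muln_gt0 => -> ->.
  by rewrite muln_gt0 fact_gt0 expn_gt0 fact_gt0.
rewrite symE; apply: (mulIf sym_neq0).
rewrite -natrM e_mu_symmetries card_summand_families mulrAC divfK // natrM natr_sum.
by congr (_ * _); apply: eq_bigr => A _; rewrite natrM !natr_prod.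
Qed.
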